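(* Let $(E,G)$ be a Riemannian Lie algebroid over $M$ with Levi-Civita connection $\nabla$. A section $u\in\mathrm{Sec}(E)$ is a Killing section if and only if $$\langle\nabla_vu|w\rangle+\langle\nabla_wu|v\rangle=0$$ for all $v,w\in\mathrm{Sec}(E)$.
   Context: A Lie algebroid is a vector bundle $E\to M$ with a Lie bracket $[\cdot,\cdot]$ on its space of smooth sections $\mathrm{Sec}(E)$ and an anchor $\rho:\mathrm{Sec}(E)\to\mathrm{Vect}(M)$ (induced by a vector bundle map $E\to TM$) such that $[u,fv]=\rho(u)[f]\,v+f[u,v]$ for all $u,v\in \mathrm{Sec}(E)$, $f\in C^\infty(M)$. With local coordinates $x^A$ on $M$ and a local basis of sections $(s_a)$, the structure functions are given by $[s_a,s_b]=Q_{ab}^c(x)s_c$ and $\rho(s_a)=Q_a^A(x)\frac{\partial}{\partial x^A}$; $(x^A,y^a)$ are the induced coordinates on $E$. Repeated indices are summed. A Riemannian metric on $E$ is a smooth assignment of an inner product to each fibre, $\langle u|v\rangle=G_{ab}(x)u^av^b$, with no compatibility with the Lie algebroid structure required; $(E,G)$ is then called a Riemannian Lie algebroid. The metric is also regarded as the quadratic function $G=y^ay^bG_{ba}$ on $E$. A (Lie algebroid) connection is a map $\nabla:\mathrm{Sec}(E)\times\mathrm{Sec}(E)\to\mathrm{Sec}(E)$, additive in each argument, with $\nabla_{fu}v=f\nabla_uv$ and $\nabla_u(fv)=f\nabla_uv+\rho(u)[f]\,v$. The Levi-Civita connection of $(E,G)$ is the unique connection which is torsionless, $\nabla_uv-\nabla_vu=[u,v]$,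 and metric compatible, $\rho(u)\langle v|w\rangle=\langle\nabla_uv|w\rangle+\langle v|\nabla_uw\rangle$. The tangent lift of $u=u^as_a\in \mathrm{Sec}(E)$ is the vector field on $E$ $$d_T(u)=u^aQ_a^A\frac{\partial}{\partial x^A}+\left(y^aQ_a^A\frac{\partial u^c}{\partial x^A}-y^au^bQ_{ba}^c\right)\frac{\partial}{\partial y^c}.$$ The section $u$ is a Killing section of $(E,G)$ if $\mathcal{L}_uG:=d_T(u)[G]=0$. *)

(* Defs.v *)
From HB Require Import structures.
From mathcomp Require Import all_boot all_order all_algebra.
From mathcomp Require Import all_classical all_reals all_analysis.
Set Implicit Arguments.
Unset Strict Implicit.
Unset Printing Implicit Defensive.
Import Order.TTheory GRing.Theory Num.Theory numFieldNormedType.Exports.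
Local Open Scope classical_set_scope.
Local Open Scope ring_scope.

Section Manifolds.
Variables (R : realType) (n : nat).

(* C^infty on an open O: every iterated partial derivative is continuous and
   partially differentiable on O. The values of f outside O play no role. *)
Definition smooth_on_Rn (O : set 'rV[R]_n) (f : 'rV[R]_n -> R) : Prop :=
  forall (s : seq 'I_n) (x : 'rV[R]_n), O x ->
    let g : 'rV[R]_n -> R := foldr (fun i h z => 'D_'e_i h z) f s in
    {for x, continuous g} /\ forall i, derivable g x 'e_i.

(* The two maps are total, but only meaningful on cdom and cimg. *)
Record chart (M : topologicalType) := Chart {
  cdom : set M;
  cimg : set 'rV[R]_n;
  cfwd : M -> 'rV[R]_n;
  cinv : 'rV[R]_n -> M;
  cdom_open : open cdom;
  cimg_open : open cimg;
  cfwd_img : forall p, cdom p -> cimg (cfwd p);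
  cinv_dom : forall x, cimg x -> cdom (cinv x);
  cfwdK : forall p, cdom p -> cinv (cfwd p) = p;
  cinvK : forall x, cimg x -> cfwd (cinv x) = x;
  cfwd_cont : forall p, cdom p -> {for p, continuous cfwd};
  cinv_cont : forall x, cimg x -> {for x, continuous cinv} }.

Definition smooth_transition (M : topologicalType) (c d : chart M) : Prop :=
  forall A : 'I_n,
    smooth_on_Rn [set x | cimg c x /\ cdom d (cinv c x)]
                 (fun x => cfwd d (cinv c x) 0 A).

Definition compatible (M : topologicalType) (c d : chart M) : Prop :=
  smooth_transition c d /\ smooth_transition d c.

Record manifold := Manifold {
  mspace :> topologicalType;
  m_hausdorff : hausdorff_space mspace;
  m_second_countable : @second_countable mspace;
  atlas : set (chart mspace);
  atlas_cover : forall p, exists2 c, atlas c & cdom c p;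
  atlas_compatible : forall c d, atlas c -> atlas d -> compatible c d;
  atlas_maximal : forall c, (forall d, atlas d -> compatible c d) -> atlas c }.

Variable M : manifold.

Definition smooth_on (U : set M) (f : M -> R) : Prop :=
  forall c, atlas c ->
    smooth_on_Rn [set x | cimg c x /\ U (cinv c x)] (f \o cinv c).

Definition smooth_at (p : M) (f : M -> R) : Prop :=
  exists U : set M, [/\ open U, U p & smooth_on U f].

(* The coordinate vector field d/dx^A of the chart c, applied to f at p. *)
Definition ddx (c : chart M) (A : 'I_n) (f : M -> R) (p : M) : R :=
  'D_'e_A (f \o cinv c) (cfwd c p).

(* Elements of T_pM, as operators D on functions smooth near p: in any local
   coordinates around p, D = v^A d/dx^A. *)
Definition tangent_vector (p : M) (D : (M -> R) -> R) : Prop :=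
  forall c, atlas c -> cdom c p ->
    exists v : 'rV[R]_n, forall f, smooth_at p f ->
      D f = \sum_A v 0 A * ddx c A f p.

End Manifolds.

Section Bundles.
Variables (R : realType) (n : nat) (M : manifold R n) (r : nat).

Record trivialization (E : M -> lmodType R) := Trivialization {
  tdom : set M;
  tcoord : forall p, E p -> 'rV[R]_r;
  tinv : forall p, 'rV[R]_r -> E p;
  tdom_open : open tdom;
  tcoord_linear : forall p, tdom p -> linear (@tcoord p);
  tcoordK : forall p, tdom p -> cancel (@tcoord p) (tinv p);
  tinvK : forall p, tdom p -> cancel (tinv p) (@tcoord p) }.

(* A rank r smooth vector bundle, given by its fibres and local
   trivializations with smooth transition functions. *)
Record vector_bundle := VectorBundle {
  fibre :> M -> lmodType R;
  trivs : set (trivialization fibre);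
  trivs_cover : forall p, exists2 t, trivs t & tdom t p;
  trivs_smooth : forall t t', trivs t -> trivs t' ->
    forall (y : 'rV[R]_r) (a : 'I_r),
      smooth_on (tdom t `&` tdom t') (fun p => tcoord t' (tinv t p y) 0 a) }.

Variable E : vector_bundle.

(* All set-theoretic sections; Sec(E) is singled out by smooth_sec. *)
Definition rough_section : Type := forall p : M, E p.

(* A local section over U is represented by any rough section extending it. *)
Definition smooth_sec_on (U : set M) (s : rough_section) : Prop :=
  forall t, trivs t -> forall a : 'I_r,
    smooth_on (U `&` tdom t) (fun p => tcoord t (s p) 0 a).

Definition smooth_sec (s : rough_section) : Prop := smooth_sec_on setT s.

Definition frame_comb (s : 'I_r -> rough_section) (p : M) (y : 'rV[R]_r) : E p :=
  \sum_a y 0 a *: s a p.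

Definition local_frame (U : set M) (s : 'I_r -> rough_section) : Prop :=
  (forall a, smooth_sec_on U (s a)) /\
  (forall p, U p -> bijective (frame_comb s p)).

End Bundles.

Section LieAlgebroids.
Variables (R : realType) (n : nat) (M : manifold R n) (r : nat).

(* The bracket and the covariant derivatives below are constrained on smooth
   sections only; their values on other rough sections are irrelevant. *)
Record lie_algebroid := LieAlgebroid {
  la_bundle :> vector_bundle M r;
  bracket : rough_section la_bundle -> rough_section la_bundle ->
            rough_section la_bundle;
  anchor : forall p, la_bundle p -> (M -> R) -> R;
  bracket_smooth : forall u v, smooth_sec u -> smooth_sec v ->
    smooth_sec (bracket u v);
  bracket_linear : forall (k : R) u v w,
    smooth_sec u -> smooth_sec v -> smooth_sec w -> forall p,
    bracket u (fun q => k *: v q + w q) p = k *: bracket u v p + bracket u w p;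
  bracket_anti : forall u v, smooth_sec u -> smooth_sec v -> forall p,
    bracket u v p = - bracket v u p;
  bracket_jacobi : forall u v w,
    smooth_sec u -> smooth_sec v -> smooth_sec w -> forall p,
    bracket u (bracket v w) p + bracket v (bracket w u) p
      + bracket w (bracket u v) p = 0;
  (* anchor is a smooth vector bundle map to the tangent bundle *)
  anchor_tangent : forall p (e : la_bundle p), tangent_vector p (anchor e);
  anchor_linear : forall p (k : R) (e e' : la_bundle p) f, smooth_at p f ->
    anchor (k *: e + e') f = k * anchor e f + anchor e' f;
  anchor_smooth : forall (U : set M) (s : rough_section la_bundle) f,
    open U -> smooth_sec_on U s -> smooth_on U f ->
    smooth_on U (fun p => anchor (s p) f);
  bracket_leibniz : forall u v f,
    smooth_sec u -> smooth_sec v -> smooth_on setT f -> forall p,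
    bracket u (fun q => f q *: v q) p
      = anchor (u p) f *: v p + f p *: bracket u v p }.

Variable E : lie_algebroid.

Record riemannian_metric := RiemannianMetric {
  inner :> forall p, E p -> E p -> R;
  inner_linear : forall p (k : R) (e e' e'' : E p),
    inner (k *: e + e') e'' = k * inner e e'' + inner e' e'';
  inner_sym : forall p (e e' : E p), inner e e' = inner e' e;
  inner_pos : forall p (e : E p), e != 0 -> 0 < inner e e;
  inner_smooth : forall (U : set M) (s t : rough_section E), open U ->
    smooth_sec_on U s -> smooth_sec_on U t ->
    smooth_on U (fun p => inner (s p) (t p)) }.

Variable g : riemannian_metric.

Record is_connection
    (nabla : rough_section E -> rough_section E -> rough_section E) : Prop := {
  nabla_smooth : forall u v, smooth_sec u -> smooth_sec v ->
    smooth_sec (nabla u v);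
  nabla_addl : forall u u' v,
    smooth_sec u -> smooth_sec u' -> smooth_sec v -> forall p,
    nabla (fun q => u q + u' q) v p = nabla u v p + nabla u' v p;
  nabla_addr : forall u v v',
    smooth_sec u -> smooth_sec v -> smooth_sec v' -> forall p,
    nabla u (fun q => v q + v' q) p = nabla u v p + nabla u v' p;
  nabla_scale : forall u v f,
    smooth_sec u -> smooth_sec v -> smooth_on setT f -> forall p,
    nabla (fun q => f q *: u q) v p = f p *: nabla u v p;
  nabla_leibniz : forall u v f,
    smooth_sec u -> smooth_sec v -> smooth_on setT f -> forall p,
    nabla u (fun q => f q *: v q) p
      = f p *: nabla u v p + anchor (u p) f *: v p }.

Record levi_civita
    (nabla : rough_section E -> rough_section E -> rough_section E) : Prop := {
  lc_connection : is_connection nabla;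
  lc_torsionless : forall u v : rough_section E,
    smooth_sec u -> smooth_sec v -> forall p,
    nabla u v p - nabla v u p = bracket u v p;
  lc_metric : forall u v w : rough_section E,
    smooth_sec u -> smooth_sec v -> smooth_sec w -> forall p,
    anchor (u p) (fun q => g q (v q) (w q))
      = g p (nabla u v p) (w p) + g p (v p) (nabla u w p) }.

(* rho(s_a) = Q_a^A d/dx^A on U and the domain of c, with QA a A = Q_a^A. *)
Definition anchor_components (c : chart R n M) (U : set M)
    (s : 'I_r -> rough_section E) (QA : 'I_r -> 'I_n -> M -> R) : Prop :=
  forall a p, U p -> cdom c p -> forall f, smooth_at p f ->
    anchor (s a p) f = \sum_A QA a A p * ddx c A f p.

(* [s_a, s_b] = Q_ab^c s_c on U, with Qb a b c = Q_ab^c. The bracket of the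
   local sections s_a, s_b at p is that of any global smooth sections which
   agree with them near p. *)
Definition bracket_components (U : set M)
    (s : 'I_r -> rough_section E) (Qb : 'I_r -> 'I_r -> 'I_r -> M -> R) : Prop :=
  forall a b p, U p -> forall v w, smooth_sec v -> smooth_sec w ->
    (\forall q \near p, v q = s a q) -> (\forall q \near p, w q = s b q) ->
    bracket v w p = \sum_d Qb a b d p *: s d p.

(* The derivative d_T(u)[F] at the point of the total space with base point p
   and fibre coordinates y, for F a function on the total space and u = u^a s_a. *)
Definition tangent_lift_coord (c : chart R n M) (s : 'I_r -> rough_section E)
    (QA : 'I_r -> 'I_n -> M -> R) (Qb : 'I_r -> 'I_r -> 'I_r -> M -> R)
    (uc : 'I_r -> M -> R) (F : forall p, E p -> R) (p : M) (y : 'rV[R]_r) : R :=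
  \sum_A (\sum_a uc a p * QA a A p)
         * ddx c A (fun q => F q (frame_comb s q y)) p
  + \sum_d (\sum_a \sum_A y 0 a * QA a A p * ddx c A (uc d) p
            - \sum_a \sum_b y 0 a * uc b p * Qb b a d p)
           * 'D_'e_d (fun z : 'rV[R]_r => F p (frame_comb s p z)) y.

(* d_T(u)[F] = 0, i.e. its expression vanishes in all local coordinates
   (x^A, y^a), so everywhere on the total space. *)
Definition tangent_lift_annihilates (u : rough_section E)
    (F : forall p, E p -> R) : Prop :=
  forall (c : chart R n M) (U : set M) (s : 'I_r -> rough_section E)
         (QA : 'I_r -> 'I_n -> M -> R) (Qb : 'I_r -> 'I_r -> 'I_r -> M -> R)
         (uc : 'I_r -> M -> R),
    atlas c -> open U -> local_frame U s ->
    anchor_components c U s QA -> bracket_components U s Qb ->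
    (forall p, U p -> u p = \sum_a uc a p *: s a p) ->
    forall p (y : 'rV[R]_r), U p -> cdom c p ->
      tangent_lift_coord c s QA Qb uc F p y = 0.

Definition metric_function (p : M) (e : E p) : R := g p e e.

Definition killing (u : rough_section E) : Prop :=
  tangent_lift_annihilates u metric_function.

End LieAlgebroids.

(* Main.v *)
(* Everything rests on the identity d_T(u)[G](V) = 2 <nabla_V u | V>.  For a
   section V with constant components in a local frame, d_T(u)[G] evaluated on V
   is rho(u)<V|V> - 2 <[u, V] | V>; metric compatibility turns the first term
   into 2 <nabla_u V | V>, and vanishing torsion gives
   nabla_u V - [u, V] = nabla_V u.  The theorem follows by polarization.  As the
   bracket and the connection act on global sections, the local computation has
   to be cut off by smooth bump functions. *)
Require Import Defs.
From mathcomp Require Import all_boot all_order all_algebra.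
From mathcomp Require Import all_classical all_reals all_analysis.
From mathcomp Require Import ring lra.
Set Implicit Arguments.
Unset Strict Implicit.
Unset Printing Implicit Defensive.
Import Order.TTheory GRing.Theory Num.Theory numFieldNormedType.Exports.
Local Open Scope classical_set_scope.
Local Open Scope ring_scope.


(** * Smooth functions and bump functions *)

(** The cut-offs are harmless because a function equal to 1 near a point is killed there by every
    anchor, so the Leibniz terms that it creates vanish. Two points go beyond the central identity.
    First, [killing] quantifies over all component functions of the anchor and the bracket, so using
    it as a hypothesis requires that such functions exist; for the bracket this rests on its
    locality. Second, the section [V] with constant components agrees with a prescribed section only
    at one point, so the value of [nabla V u] there must depend on the value of [V] alone.
    Smoothness asks for all iterated partial derivatives, which is why the bump functions are built
    inside a class of functions closed under differentiation. *)

Section Flat.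
Context {R : realType}.

(* The powers of 1/t make the family stable under differentiation. *)
Definition flat (k : nat) (t : R) : R :=
  if 0 < t then t^-1 ^+ k * expR (- t^-1) else 0.

Lemma flat_eq0 k t : t <= 0 -> flat k t = 0.
Proof. by rewrite /flat leNgt => /negbTE ->. Qed.

Lemma flat_gt0 k t : 0 < t -> 0 < flat k t.
Proof. by move=> t0; rewrite /flat t0 mulr_gt0 ?expR_gt0 ?exprn_gt0 ?invr_gt0. Qed.

Lemma flat_ge0 k t : 0 <= flat k t.
Proof. by case: (lerP t 0) => [/flat_eq0 ->//|/(flat_gt0 k)/ltW]. Qed.

Lemma flatS k t : flat k.+1 t = t^-1 * flat k t.
Proof. by rewrite /flat; case: ifP; rewrite ?mulr0// exprS mulrA. Qed.

(** With x = 1/t, the exponential series gives x^(k+1) / (k+1)! <= e^x. The linear bound is what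
    makes the derivative at 0 exist. *)
Lemma flat_le k t : flat k t <= (k.+1)`!%:R * `|t|.
Proof.
case: (lerP t 0) => [/flat_eq0 ->|t0]; first by rewrite mulr_ge0.
rewrite gtr0_norm // /flat t0 expRN.
have x0 : 0 < t^-1 by rewrite invr_gt0.
have := expR_ge1Dxn k (ltW x0).
have f0 : 0 < (k.+1)`!%:R :> R by rewrite ltr0n fact_gt0.
move=> h; have {}h : t^-1 ^+ k.+1 / (k.+1)`!%:R <= expR t^-1 by lra.
rewrite ler_pdivrMr ?expR_gt0 //.
move: h; rewrite ler_pdivrMr // => h.
have -> : t^-1 ^+ k = t * t^-1 ^+ k.+1 by rewrite exprS mulrA divff ?mul1r ?gt_eqF.
have := ler_wpM2l (ltW t0) h; lra.
Qed.

Lemma is_derive_flat k (t : R) :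
  is_derive t 1 (flat k) (- k%:R * flat k.+1 t + flat k.+2 t).
Proof.
case: (ltrgtP t 0) => [t0|t0|->].
- rewrite !flat_eq0 ?ltW // mulr0 addr0.
  apply: (@near_eq_is_derive _ _ _ (cst 0)).
    near=> s; rewrite flat_eq0 // ltW //; near: s; exact: lt_nbhsl.
- have tn0 : t != 0 by rewrite gt_eqF.
  apply: (@near_eq_is_derive _ _ _ (fun s : R => s^-1 ^+ k * expR (- s^-1))).
    near=> s; have s0 : 0 < s by near: s; exact: lt_nbhsr.
    by rewrite /flat s0.
  have dV : is_derive t 1 (fun s : R => s^-1) (- (t^-1 * t^-1)).
    have d : derivable (id : R -> R) t 1 by exact: derivable_id.
    split; first exact: derivableV.
    by rewrite (deriveV tn0 d) derive_id /GRing.scale /= mulr1 expr2 invfM.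
  have dN : is_derive t 1 (fun s : R => - s^-1) ((t^-1 * t^-1)).
    by apply: is_derive_eq; rewrite opprK.
  have dE : is_derive t 1 (fun s : R => expR (- s^-1)) (expR (- t^-1) * (t^-1 * t^-1)).
    exact: (@is_derive1_comp _ expR).
  have dX : is_derive t 1 (fun s : R => s^-1 ^+ k) (k%:R * t^-1 ^+ k.-1 * - (t^-1 * t^-1)).
    by have := is_deriveX k dV; rewrite exprfctE.
  apply: (@is_derive_eq _ _ _ _ _ _ _ _ (is_deriveM dX dE)).
  rewrite /flat t0 /GRing.scale /= !exprS.
  case: k {dX} => [|k] /=; first by rewrite mulr0n oppr0 !mul0r; ring.
  rewrite exprS; set x := t^-1; set E := expR _.
  have -> : 1 *- k.+1 = - (k.+1%:R : R) by [].
  by move: (k.+1%:R : R) => K; ring.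
- rewrite !flat_eq0 // mulr0 addr0.
  (* The difference quotient of [flat k] at 0 is [flat k.+1] itself, and [flat_le] sends it to 0. *)
  have cv : h^-1 *: ((flat k \o shift 0) (h *: 1) - flat k 0) @[h --> 0^'] --> (0 : R).
    apply: (@cvg_trans _ (flat k.+1 h @[h --> (0:R)^'])).
      apply: near_eq_cvg; near=> h.
      by rewrite flatS (@flat_eq0 k 0) // subr0 /= /GRing.scale /= mulr1 addr0.
    apply/cvgr0Pnorm_le => e e0; near=> h.
    rewrite ger0_norm ?flat_ge0 // (le_trans (flat_le _ _)) //.
    have f0 : 0 < (k.+2)`!%:R :> R by rewrite ltr0n fact_gt0.
    rewrite mulrC -ler_pdivlMr //; near: h.
    apply: dnbhs0_le; exact: divr_gt0.
  split; first by apply/cvg_ex; exists (0 : R); exact: cv.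
  by apply/cvg_lim => //; exact: cv.
Unshelve. all: by end_near.
Qed.

(** A directional derivative is an ordinary derivative along the line s |-> s v + x, so the
    one-variable chain rule applies and [f] has to be derivable in the direction [v] only. *)
Lemma is_derive_comp1 (V : normedModType R) (h : R -> R) (f : V -> R) (x v : V) (dh df : R) :
  is_derive (f x) 1 h dh -> is_derive x v f df ->
  is_derive x v (h \o f) (dh * df).
Proof.
have line (k : V -> R) d :
    is_derive x v k d <-> is_derive (0 : R) 1 (fun s : R => k (s *: v + x)) d.
  have e : 'D_v k x = 'D_1 (fun s : R => k (s *: v + x)) 0.
    rewrite /derive; set q1 := fun h => _; set q2 := fun h => _.
    suff -> : q1 = q2 by [].
    by rewrite funeqE /q1 /q2 => s /=; rewrite addr0 scale0r add0r [_%:A]mulr1.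
  split=> -[d1 <-]; split; rewrite ?e //.
    exact: (derivable1P k x v).1.
  exact: (derivable1P k x v).2.
move=> dh' /line df'; apply/line.
apply: (@is_derive1_comp _ h (fun s : R => f (s *: v + x)) 0 dh df).
by rewrite /= scale0r add0r.
Qed.

End Flat.

Section SmoothAlgebra.
Context {R : realType} {n : nat} (O : set 'rV[R]_n).
Implicit Types f g : 'rV[R]_n -> R.

(* Up to equality on O this class is closed under the partial derivatives, which
   gives smoothness of its members without computing iterated derivatives. *)
Inductive smooth_alg : ('rV[R]_n -> R) -> Prop :=
| alg_smooth f of smooth_on_Rn O f : smooth_alg f
| alg_cst k : smooth_alg (fun=> k)
| alg_add f g of smooth_alg f & smooth_alg g : smooth_alg (fun x => f x + g x)
| alg_mul f g of smooth_alg f & smooth_alg g : smooth_alg (fun x => f x * g x)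
| alg_inv f of smooth_alg f & (forall x, O x -> f x != 0) :
    smooth_alg (fun x => (f x)^-1)
| alg_flat k f of smooth_alg f : smooth_alg (fun x => flat k (f x))
| alg_eq f g of smooth_alg f & (forall x, O x -> f x = g x) : smooth_alg g.

Lemma smooth_on_Rn_deriv f i :
  smooth_on_Rn O f -> smooth_on_Rn O (fun x => 'D_'e_i f x).
Proof. by move=> sf s x Ox; have := sf (rcons s i) x Ox; rewrite foldr_rcons. Qed.

Hypothesis Oo : open O.

Lemma near_open_eq f g x : O x -> (forall x, O x -> f x = g x) ->
  \near x, f x = g x.
Proof.
move=> Ox fg; have : nbhs x O by exact: open_nbhs_nbhs.
exact: filterS.
Qed.

Lemma smooth_alg_cont f x : smooth_alg f -> O x -> {for x, continuous f}.
Proof.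
move=> + Ox; elim=> {f} [f /(_ [::] x Ox)[]//|k|f g _ cf _ cg|f g _ cf _ cg
  |f _ cf f0|k f _ cf|f g _ cf fg].
- exact: cst_continuous.
- exact: (cvgD cf cg).
- exact: (cvgM cf cg).
- exact: (cvgV (f0 _ Ox) cf).
- apply: (@continuous_comp _ _ _ f (flat k) x cf).
  have [d _] := is_derive_flat k (f x).
  exact/differentiable_continuous/derivable1_diffP.
- have cfg : f y @[y --> x] --> g x by rewrite -fg.
  apply: cvg_trans cfg; apply: (@near_eq_cvg _ _ (nbhs x)).
  exact: near_open_eq Ox fg.
Qed.

Lemma smooth_alg_is_derive f i : smooth_alg f ->
  exists2 f', smooth_alg f' & forall x, O x -> is_derive x 'e_i f (f' x).
Proof.
elim=> {f} [f sf|k|f g sf [f' sf' df] sg [g' sg' dg]|f g sf [f' sf' df] sg [g' sg' dg]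
  |f sf [f' sf' df] f0|k f sf [f' sf' df]|f g sf [f' sf' df] fg].
- exists (fun x => 'D_'e_i f x); first exact/alg_smooth/smooth_on_Rn_deriv.
  by move=> x Ox; apply: derivableP; have [_] := sf [::] x Ox; apply.
- exists (fun=> 0); first exact: alg_cst.
  by move=> x Ox; exact: is_derive_cst.
- exists (fun x => f' x + g' x); first exact: alg_add.
  by move=> x Ox; exact: is_deriveD (df _ Ox) (dg _ Ox).
- exists (fun x => f x * g' x + g x * f' x).
    by apply: alg_add; apply: alg_mul.
  by move=> x Ox; exact: is_deriveM (df _ Ox) (dg _ Ox).
- exists (fun x => - 1 * ((f x)^-1 * (f x)^-1) * f' x).
    by do !apply: alg_mul => //; [exact: alg_cst|exact: alg_inv|exact: alg_inv].
  move=> x Ox; have [d e] := df _ Ox; split; first exact: derivableV (f0 _ Ox) d.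
  rewrite deriveV ?f0 // e /GRing.scale /= mulN1r.
  by rewrite -invfM expr2.
- exists (fun x => (- k%:R * flat k.+1 (f x) + flat k.+2 (f x)) * f' x).
    apply: alg_mul => //; apply: alg_add; last exact: alg_flat.
    by apply: alg_mul; [exact: alg_cst|exact: alg_flat].
  by move=> x Ox; exact: is_derive_comp1 (is_derive_flat _ _) (df _ Ox).
- exists f' => // x Ox; apply: near_eq_is_derive (df _ Ox).
  exact: near_open_eq.
Qed.

(** By [smooth_alg_is_derive] and [alg_eq], every iterated partial derivative is again in the class,
    and members of the class are continuous and partially differentiable on [O]. *)
Lemma smooth_algP f : smooth_alg f -> smooth_on_Rn O f.
Proof.
move=> sf s.
have {sf} : smooth_alg (foldr (fun i h z => 'D_'e_i h z) f s).
  elim: s => [//|i s ih] /=.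
  have [f' sf' df] := smooth_alg_is_derive i ih.
  apply: alg_eq sf' _ => x Ox.
  by have [_ ->] := df _ Ox.
set h := foldr _ _ _ => sh x Ox; split; first exact: smooth_alg_cont sh Ox.
by move=> i; have [f' _ /(_ _ Ox)[]] := smooth_alg_is_derive i sh.
Qed.

End SmoothAlgebra.

Section SmoothStep.
Context {R : realType}.

Definition smooth_step (t : R) : R :=
  flat 0 (2 - t) / (flat 0 (2 - t) + flat 0 (t - 1)).

(** Both terms are nonnegative, and one is positive since t < 2 or t > 1. *)
Lemma smooth_step_den t : flat 0 (2 - t) + flat 0 (t - 1) != 0 :> R.
Proof.
rewrite gt_eqF //; case: (ltrP t 2) => ht.
  by rewrite ltr_wpDr ?flat_ge0 ?flat_gt0 // subr_gt0.
by rewrite ltr_wpDl ?flat_ge0 ?flat_gt0 //; lra.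
Qed.

Lemma smooth_step1 t : t <= 1 -> smooth_step t = 1.
Proof.
move=> t1; have := smooth_step_den t.
by rewrite /smooth_step (@flat_eq0 _ 0 (t - 1)) ?subr_le0 // addr0; apply: divff.
Qed.

Lemma smooth_step0 t : 2 <= t -> smooth_step t = 0.
Proof. by move=> t2; rewrite /smooth_step flat_eq0 ?subr_le0 ?mul0r. Qed.

Lemma smooth_alg_sum n (O : set 'rV[R]_n) I (s : seq I) (P : pred I)
    (F : I -> 'rV[R]_n -> R) :
  (forall i, smooth_alg O (F i)) -> smooth_alg O (fun x => \sum_(i <- s | P i) F i x).
Proof.
move=> sF; elim: s => [|i s ih].
  by apply: alg_eq (alg_cst O 0) _ => x _; rewrite big_nil.
case Pi : (P i); last by apply: alg_eq ih _ => x _; rewrite big_cons Pi.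
by apply: alg_eq (alg_add (sF i) ih) _ => x _; rewrite big_cons Pi.
Qed.

Lemma smooth_alg_step n (O : set 'rV[R]_n) f :
  smooth_alg O f -> smooth_alg O (fun x => smooth_step (f x)).
Proof.
move=> sf.
have s1 : smooth_alg O (fun x => flat 0 (2 - f x)).
  apply: alg_flat.
  apply: alg_eq (alg_add (alg_cst O 2) (alg_mul (alg_cst O (-1)) sf)) _ => x _.
  by rewrite mulN1r.
have s2 : smooth_alg O (fun x => flat 0 (f x - 1)).
  by apply: alg_flat; exact: alg_add sf (alg_cst O (-1)).
apply: (alg_mul s1); apply: alg_inv; first exact: (alg_add s1 s2).
by move=> x _; exact: smooth_step_den.
Qed.

End SmoothStep.

(** * Smooth functions and cut-offs on a manifold *)

Section ManifoldFunctions.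
Context {R : realType} {n : nat} {M : manifold R n}.
Implicit Types (U V W : set M) (f g : M -> R) (c d : chart R n M).

Lemma open_chart_region c U :
  open U -> open [set x | cimg c x /\ U (cinv c x)].
Proof.
move=> oU; rewrite openE => x [cx Ux]; apply: filterI.
  by apply: open_nbhs_nbhs; split => //; exact: cimg_open.
by apply: (cinv_cont cx); exact: open_nbhs_nbhs.
Qed.

(** Smoothness is a condition at each point on the derivatives of a total function, so the sets [V]
    may be arbitrary. *)
Lemma smooth_on_local U f :
  (forall p, U p -> exists2 V, V p & smooth_on V f) -> smooth_on U f.
Proof.
move=> loc c ac s x [cx Ux]; have [V Vx sV] := loc _ Ux.
exact: (sV c ac s x).
Qed.

Lemma smooth_onS V U f : V `<=` U -> smooth_on U f -> smooth_on V f.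
Proof. by move=> VU sU; apply: smooth_on_local => p /VU; exists U. Qed.

Lemma smooth_on_alg U f : open U ->
  (forall c, atlas c ->
    smooth_alg [set x | cimg c x /\ U (cinv c x)] (f \o cinv c)) ->
  smooth_on U f.
Proof.
by move=> oU sf c ac; apply: smooth_algP; [exact: open_chart_region|exact: sf].
Qed.

Section Algebra.
Variable U : set M.
Hypothesis oU : open U.

Lemma smooth_on_cst k : smooth_on U (fun=> k).
Proof. by apply: smooth_on_alg => // c _; exact: alg_cst. Qed.

Lemma smooth_onD f g :
  smooth_on U f -> smooth_on U g -> smooth_on U (fun p => f p + g p).
Proof.
move=> sf sg; apply: smooth_on_alg => // c ac.
exact: alg_add (alg_smooth (sf c ac)) (alg_smooth (sg c ac)).
Qed.

Lemma smooth_onM f g :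
  smooth_on U f -> smooth_on U g -> smooth_on U (fun p => f p * g p).
Proof.
move=> sf sg; apply: smooth_on_alg => // c ac.
exact: alg_mul (alg_smooth (sf c ac)) (alg_smooth (sg c ac)).
Qed.

Lemma smooth_onV f : (forall p, U p -> f p != 0) ->
  smooth_on U f -> smooth_on U (fun p => (f p)^-1).
Proof.
move=> f0 sf; apply: smooth_on_alg => // c ac.
by apply: alg_inv (alg_smooth (sf c ac)) _ => x [_ /f0].
Qed.

Lemma smooth_on_eq f g : (forall p, U p -> f p = g p) ->
  smooth_on U f -> smooth_on U g.
Proof.
move=> fg sf; apply: smooth_on_alg => // c ac.
by apply: alg_eq (alg_smooth (sf c ac)) _ => x [_ /fg].
Qed.

Lemma smooth_on_sum I (s : seq I) (P : pred I) (F : I -> M -> R) :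
  (forall i, smooth_on U (F i)) ->
  smooth_on U (fun p => \sum_(i <- s | P i) F i p).
Proof.
move=> sF; apply: smooth_on_alg => // c ac.
exact: (smooth_alg_sum s P (fun i => alg_smooth (sF i c ac))).
Qed.

Lemma smooth_on_prod I (s : seq I) (F : I -> M -> R) :
  (forall i, smooth_on U (F i)) -> smooth_on U (fun p => \prod_(i <- s) F i p).
Proof.
move=> sF; elim: s => [|i s ih].
  by apply: smooth_on_eq (smooth_on_cst 1) => p _; rewrite big_nil.
by apply: smooth_on_eq (smooth_onM (sF i) ih) => p _; rewrite big_cons.
Qed.

Lemma smooth_on_det m (A : M -> 'M[R]_m) :
  (forall i j, smooth_on U (fun p => A p i j)) -> smooth_on U (fun p => \det (A p)).
Proof.
move=> sA; apply: smooth_on_sum => s; apply: smooth_onM; first exact: smooth_on_cst.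
by apply: smooth_on_prod => i; exact: sA.
Qed.

Lemma smooth_on_adj m (A : M -> 'M[R]_m) :
  (forall i j, smooth_on U (fun p => A p i j)) ->
  forall i j, smooth_on U (fun p => (\adj (A p)) i j).
Proof.
move=> sA i j.
apply: (@smooth_on_eq (fun p => (-1) ^+ (j + i) * \det (row' j (col' i (A p))))).
  by move=> p _; rewrite mxE.
apply: smooth_onM; first exact: smooth_on_cst.
apply: smooth_on_det => k l.
by apply: smooth_on_eq (sA (lift j k) (lift i l)) => p _; rewrite !mxE.
Qed.

End Algebra.

(* The square of the distance to a centre, read in one chart, is a polynomial
   in the transition functions of every other chart: no chain rule is needed. *)
Lemma bump_function U (p : M) : open U -> U p ->
  exists chi W, [/\ smooth_on setT chi, \forall q \near p, chi q = 1, open W,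
    forall q, W q -> chi q = 0 & forall q, U q \/ W q].
Proof.
move=> oU Up; have [c ac cp] := atlas_cover p.
pose O := [set x | cimg c x /\ U (cinv c x)].
pose x0 := cfwd c p.
have Ox0 : O x0 by split; [exact: cfwd_img|rewrite /x0 cfwdK].
have [e /= e0 eO] : exists2 e : R, 0 < e & ball x0 e `<=` O.
  have : nbhs x0 O.
    by apply: open_nbhs_nbhs; split => //; exact: open_chart_region.
  by move=> /nbhs_ballP[e e0 eO]; exists e.
(* Balls are taken coordinatewise, so the closed box of half-width [e / 2] fits in the ball of
   radius [e]; as a product of segments it is compact. *)
pose I i : set R := `[x0 0 i - e / 2, x0 0 i + e / 2]%classic.
pose K : set 'rV[R]_n := [set v | forall i, I i (v ord0 i)].
have KO : K `<=` O.
  move=> v Kv; apply: eO; split=> // i j; rewrite ord1.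
  have := Kv j; rewrite /I /= in_itv /= => /andP[h1 h2].
  by rewrite /ball /= ltr_distl; apply/andP; split; lra.
have cK : compact (cinv c @` K).
  apply: continuous_compact; last first.
    by apply: (@rV_compact R n I) => i; exact: segment_compact.
  apply: continuous_in_subspaceT => x /set_mem /KO[cx _].
  exact: cinv_cont.
pose N (x : 'rV[R]_n) := \sum_j (x 0 j - x0 0 j) * (x 0 j - x0 0 j).
(* Chosen so that [N x < 2 * del] reads [N x < (e / 2) ^+ 2], which bounds every coordinate of
   [x - x0] by [e / 2]. *)
pose del := e ^+ 2 / 8.
have del0 : 0 < del by rewrite divr_gt0 ?exprn_gt0.
have NK x : N x / del < 2 -> K x.
  rewrite ltr_pdivrMr // => Nx i; rewrite /I /= in_itv /=.
  have le1 : (x 0 i - x0 0 i) * (x 0 i - x0 0 i) <= N x.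
    rewrite /N (bigD1 i) //= lerDl sumr_ge0 // => j _.
    by rewrite -expr2 sqr_ge0.
  move: le1 Nx; rewrite /del expr2; move: (N x) (x 0 i) (x0 0 i) => N0 a b h1 h2.
  by apply/andP; split; nra.
have sN d : atlas d -> smooth_alg [set x | cimg d x /\ cdom c (cinv d x)]
    (fun x => N (cfwd c (cinv d x)) / del).
  move=> ad; apply: alg_mul; last exact: alg_cst.
  have [tr _] := atlas_compatible ad ac.
  apply: smooth_alg_sum => j; have sj := alg_smooth (tr j).
  by apply: alg_mul; apply: alg_add => //; exact: alg_cst.
(* Extension by 0 is smooth because [chi] already vanishes off the image of the box, which is
   compact, hence closed in the Hausdorff space [M], and lies in the chart domain. *)
pose chi q := if q \in cdom c then smooth_step (N (cfwd c q) / del) else 0.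
have chi0 q : (~` (cinv c @` K)) q -> chi q = 0.
  move=> Wq; rewrite /chi; case: ifPn => // /set_mem cq.
  apply: smooth_step0; rewrite leNgt; apply/negP => /NK Kq.
  by apply: Wq; exists (cfwd c q) => //; exact: cfwdK.
have oW : open (~` (cinv c @` K)).
  by apply: closed_openC; exact: compact_closed (@m_hausdorff _ _ M) cK.
exists chi, (~` (cinv c @` K)); split => //.
- apply: smooth_on_local => q _.
  have [[x Kx <-]|nKq] := pselect ((cinv c @` K) q); last first.
    exists (~` (cinv c @` K)) => //.
    by apply: smooth_on_eq (smooth_on_cst oW 0) => // r /chi0.
  exists (cdom c); first by apply: cinv_dom; case: (KO _ Kx).
  apply: smooth_on_alg => [|d ad]; first exact: cdom_open.
  apply: alg_eq (smooth_alg_step (sN d ad)) _ => y [_ cy].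
  by rewrite /chi /= mem_set.
- have cont : {for x0, continuous (fun x => N (cfwd c (cinv c x)) / del)}.
    apply: smooth_alg_cont (sN c ac) _.
      exact/open_chart_region/cdom_open.
    by split; [exact: cfwd_img|rewrite /x0 cfwdK].
  have N0 : N (cfwd c (cinv c x0)) / del = 0.
    rewrite /x0 cfwdK // -/x0 /N big1 ?mul0r // => j _.
    by rewrite subrr mul0r.
  have lt1 : \forall x \near x0, N (cfwd c (cinv c x)) / del < 1.
    by apply: (cont [set y | y < 1]); rewrite N0; exact: lt_nbhsl.
  have {}lt1 : \forall q \near p, N (cfwd c (cinv c (cfwd c q))) / del < 1.
    exact: (cfwd_cont cp lt1).
  have cdp : \forall q \near p, cdom c q.
    by apply: open_nbhs_nbhs; split => //; exact: cdom_open.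
  near=> q.
  have cq : cdom c q by near: q.
  rewrite /chi mem_set // smooth_step1 //.
  by rewrite -{1}(cfwdK cq) ltW //; near: q.
- move=> q; have [[x /KO[_ Ux] <-]|nKq] := pselect ((cinv c @` K) q); first by left.
  by right.
Unshelve. all: by end_near.
Qed.

End ManifoldFunctions.

(** * Sections of a vector bundle *)

Section BundleSections.
Context {R : realType} {n : nat} {M : manifold R n} {r : nat} (E : vector_bundle M r).
Implicit Types (U V W : set M) (f : M -> R) (s : rough_section E).

Lemma tcoordZD (t : trivialization r E) p k (e e' : E p) : tdom t p ->
  tcoord t (k *: e + e') = k *: tcoord t e + tcoord t e'.
Proof. by move=> /tcoord_linear ->. Qed.

Lemma tcoord0 (t : trivialization r E) p : tdom t p -> tcoord t (0 : E p) = 0.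
Proof.
move=> tp; have := tcoordZD (-1) 0 0 tp.
by rewrite scaler0 addr0 scaleN1r addNr.
Qed.

Lemma tcoord_frame_comb (t : trivialization r E) (s : 'I_r -> rough_section E) p y :
  tdom t p -> tcoord t (frame_comb s p y) = \sum_a y 0 a *: tcoord t (s a p).
Proof.
move=> tp; rewrite /frame_comb.
elim: (index_enum _) => [|a l ih]; first by rewrite !big_nil tcoord0.
by rewrite !big_cons tcoordZD // ih.
Qed.

Lemma smooth_sec_onS U V s : V `<=` U -> smooth_sec_on U s -> smooth_sec_on V s.
Proof.
move=> VU ss t tt a; apply: smooth_onS (ss t tt a).
by move=> p [/VU].
Qed.

Section Algebra.
Variable U : set M.
Hypothesis oU : open U.

Let oUt (t : trivialization r E) : open (U `&` tdom t).
Proof. by apply: openI => //; exact: tdom_open. Qed.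

Lemma smooth_sec_on_eq s s' : (forall p, U p -> s p = s' p) ->
  smooth_sec_on U s -> smooth_sec_on U s'.
Proof.
move=> ee ss t tt a; apply: smooth_on_eq (ss t tt a) => //.
by move=> p [Up tp]; rewrite ee.
Qed.

Lemma smooth_sec_on0 : smooth_sec_on U (fun p => 0 : E p).
Proof.
move=> t tt a; apply: smooth_on_eq (smooth_on_cst (oUt t) 0) => //.
by move=> p [Up tp]; rewrite tcoord0 // mxE.
Qed.

Lemma smooth_sec_onZD f s s' : smooth_on U f -> smooth_sec_on U s ->
  smooth_sec_on U s' -> smooth_sec_on U (fun p => f p *: s p + s' p).
Proof.
move=> sf ss ss' t tt a.
have sf' : smooth_on (U `&` tdom t) f by apply: smooth_onS sf => p [].
have := smooth_onD (oUt t) (smooth_onM (oUt t) sf' (ss t tt a)) (ss' t tt a).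
apply: smooth_on_eq => //.
by move=> p [Up tp]; rewrite tcoordZD // !mxE.
Qed.

Lemma smooth_sec_onZ f s : smooth_on U f -> smooth_sec_on U s ->
  smooth_sec_on U (fun p => f p *: s p).
Proof.
move=> sf ss; apply: smooth_sec_on_eq (smooth_sec_onZD sf ss smooth_sec_on0).
by move=> p _; rewrite addr0.
Qed.

Lemma smooth_sec_onD s s' : smooth_sec_on U s -> smooth_sec_on U s' ->
  smooth_sec_on U (fun p => s p + s' p).
Proof.
move=> ss ss'; apply: smooth_sec_on_eq (smooth_sec_onZD (smooth_on_cst oU 1) ss ss').
by move=> p _; rewrite scale1r.
Qed.

Lemma smooth_sec_on_sum I (l : seq I) (F : I -> rough_section E) :
  (forall i, smooth_sec_on U (F i)) ->
  smooth_sec_on U (fun p => \sum_(i <- l) F i p).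
Proof.
move=> sF; elim: l => [|i l ih].
  by apply: smooth_sec_on_eq smooth_sec_on0 => p _; rewrite big_nil.
by apply: smooth_sec_on_eq (smooth_sec_onD (sF i) ih) => p _; rewrite big_cons.
Qed.

Lemma smooth_sec_on_frame_comb (s : 'I_r -> rough_section E) y :
  (forall a, smooth_sec_on U (s a)) ->
  smooth_sec_on U (fun p => frame_comb s p y).
Proof.
move=> ss; apply: smooth_sec_on_sum => a.
by apply: smooth_sec_onZ; first exact: smooth_on_cst.
Qed.

Variables (chi : M -> R) (W : set M).
Hypotheses (schi : smooth_on setT chi) (oW : open W)
  (chi0 : forall q, W q -> chi q = 0) (UW : forall q, U q \/ W q).

(** Smooth on [U] as a product, and on [W] because it is zero there whatever the values of [f]; [U]
    and [W] cover [M]. *)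
Lemma cutoff_smooth f : smooth_on U f -> smooth_on setT (fun p => chi p * f p).
Proof.
move=> sf; apply: smooth_on_local => p _.
have [Up|Wp] := UW p.
  by exists U => //; apply: smooth_onM => //; exact: smooth_onS schi.
exists W => //; apply: smooth_on_eq (smooth_on_cst oW 0) => //.
by move=> q /chi0 ->; rewrite mul0r.
Qed.

Lemma cutoff_smooth_sec s : smooth_sec_on U s -> smooth_sec (fun p => chi p *: s p).
Proof.
move=> ss t tt a; apply: smooth_on_local => p [_ tp].
have [Up|Wp] := UW p.
  exists (U `&` tdom t); first by split.
  by apply: (smooth_sec_onZ _ ss) => //; exact: smooth_onS schi.
exists (W `&` tdom t); first by split.
apply: smooth_on_eq (smooth_on_cst _ 0) => //; try by apply: openI; [|exact: tdom_open].
move=> q [Wq tq].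
by rewrite chi0 // scale0r tcoord0 // mxE.
Qed.

End Algebra.

(* Cramer's rule in a trivialization. *)
Lemma frame_coord_smooth U (s : 'I_r -> rough_section E) u (uc : 'I_r -> M -> R) :
  open U -> local_frame U s -> smooth_sec_on U u ->
  (forall p, U p -> u p = \sum_a uc a p *: s a p) ->
  forall a, smooth_on U (uc a).
Proof.
move=> oU [ss bs] su ue a; apply: smooth_on_local => p0 Up0.
have [t tt tp0] := trivs_cover E p0.
exists (U `&` tdom t); first by split.
have oV : open (U `&` tdom t) by apply: openI => //; exact: tdom_open.
pose A p := \matrix_(a, b) tcoord t (s a p) 0 b : 'M[R]_r.
have AE p y : tdom t p -> tcoord t (frame_comb s p y) = y *m A p.
  move=> tp; rewrite tcoord_frame_comb // mulmx_sum_row.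
  by apply: eq_bigr => i _; congr (_ *: _); apply/rowP => j; rewrite !mxE.
(* A nonzero row in the left kernel of [A p] would be a linear relation between the frame vectors at
   [p]. *)
have detA p : (U `&` tdom t) p -> \det (A p) != 0.
  move=> [Up tp]; apply/negP => /det0P[v /eqP v0 vA]; apply: v0.
  apply: (bij_inj (bs p Up)); apply: (can_inj (tcoordK tp)).
  by rewrite !AE // vA mul0mx.
have sA i j : smooth_on (U `&` tdom t) (fun p => A p i j).
  by apply: smooth_on_eq (ss i t tt j) => // p _; rewrite mxE.
have sum_smooth : smooth_on (U `&` tdom t)
    (fun p => \sum_b tcoord t (u p) 0 b * (\adj (A p)) b a).
  apply: smooth_on_sum => // b; apply: smooth_onM => //; first exact: su.
  exact: smooth_on_adj.
have := smooth_onM oV (smooth_onV oV detA (smooth_on_det oV sA)) sum_smooth.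
apply: smooth_on_eq => // p Vp; have [Up tp] := Vp.
apply: (mulfI (detA p Vp)); rewrite mulVKf ?detA //.
pose y := \row_b uc b p.
have -> : u p = frame_comb s p y.
  by rewrite ue //; apply: eq_bigr => b _; rewrite mxE.
(* The trivialized coordinates of [u p] are [y *m A p]; multiplying by the adjugate turns them into
   [\det (A p)] times [y]. *)
have := congr1 (fun z : 'rV_r => z 0 a) (mulmxA y (A p) (\adj (A p))).
rewrite /= mul_mx_adj mul_mx_scalar -AE // [in LHS]mxE [y 0 a]mxE => ->.
by rewrite mxE.
Qed.

Section TrivializationFrame.
Variable t : trivialization r E.
Hypothesis tt : trivs (v := E) t.

Definition triv_frame (a : 'I_r) : rough_section E := fun p => tinv t p 'e_a.

Lemma triv_frame_comb p y : tdom t p -> frame_comb triv_frame p y = tinv t p y.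
Proof.
move=> tp; apply: (can_inj (tcoordK tp)); rewrite tinvK // tcoord_frame_comb //.
by rewrite [RHS]row_sum_delta; apply: eq_bigr => a _; rewrite tinvK.
Qed.

Lemma triv_local_frame : local_frame (tdom t) triv_frame.
Proof.
split=> [a t' tt' b|p tp]; first exact: trivs_smooth.
exists (@tcoord _ _ _ _ _ t p) => y; rewrite triv_frame_comb //.
  exact: tinvK.
exact: tcoordK.
Qed.

End TrivializationFrame.

End BundleSections.

(** * The tangent lift of the metric *)

Section Algebroid.
Context {R : realType} {n r : nat} {M : manifold R n} (E : lie_algebroid M r).
Implicit Types (U V W : set M) (f : M -> R) (u v w : rough_section E) (c : chart R n M).

Lemma ddx_local c A f f' (p : M) : cdom c p -> (\forall q \near p, f q = f' q) ->
  ddx c A f p = ddx c A f' p.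
Proof.
move=> cp ff; apply: near_eq_derive.
have cx := cfwd_img cp.
have ff' : nbhs (cinv c (cfwd c p)) [set q | f q = f' q] by rewrite cfwdK.
exact: (cinv_cont cx ff').
Qed.

Lemma smooth_at_on U f p : open U -> U p -> smooth_on U f -> smooth_at p f.
Proof. by exists U. Qed.

Lemma anchor_local p (e : E p) f f' : smooth_at p f -> smooth_at p f' ->
  (\forall q \near p, f q = f' q) -> anchor e f = anchor e f'.
Proof.
move=> sf sf' ff; have [c ac cp] := atlas_cover p.
have [k ke] := anchor_tangent e ac cp.
by rewrite !ke //; apply: eq_bigr => A _; rewrite (ddx_local A cp ff).
Qed.

Lemma anchor_cst p (e : E p) k : anchor e (fun=> k) = 0.
Proof.
have [c ac cp] := atlas_cover p.
have [l ->] := anchor_tangent e ac cp; last first.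
  by apply: (@smooth_at_on setT) => //; [exact: openT|exact: (smooth_on_cst openT)].
by rewrite big1 // => A _; rewrite /ddx /= (derive_cst k) mulr0.
Qed.

Lemma anchor0 p f : smooth_at p f -> anchor (0 : E p) f = 0.
Proof.
move=> sf; have := anchor_linear (-1) (0 : E p) 0 sf.
by rewrite scaler0 addr0 mulN1r addNr.
Qed.

Lemma anchor_sum p f I (l : seq I) (k : I -> R) (e : I -> E p) : smooth_at p f ->
  anchor (\sum_(i <- l) k i *: e i) f = \sum_(i <- l) k i * anchor (e i) f.
Proof.
move=> sf; elim: l => [|i l ih]; first by rewrite !big_nil anchor0.
by rewrite !big_cons anchor_linear // ih.
Qed.

Lemma smooth_secE u U : smooth_sec u -> smooth_sec_on U u.
Proof. exact: smooth_sec_onS. Qed.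

Lemma sec_ext u v : (forall p, u p = v p) -> u = v.
Proof. exact: functional_extensionality_dep. Qed.

Lemma eq_sec_map (F : rough_section E -> rough_section E) u v p :
  (forall q, u q = v q) -> F u p = F v p.
Proof. by move=> /sec_ext ->. Qed.

(** * Linearity and locality of the bracket, existence of components *)

Let oT : open (setT : set M) := openT.

Lemma bracket0 u p : smooth_sec u -> bracket u (fun q => 0 : E q) p = 0.
Proof.
move=> su; have s0 := smooth_sec_on0 (E := E) oT.
have := bracket_linear (-1) su s0 s0 p.
rewrite [X in bracket u X](_ : _ = (fun q => 0 : E q)).
  by rewrite scaleN1r addNr.
by apply: sec_ext => q; rewrite scaler0 addr0.
Qed.

Lemma smooth_sec_lincomb I (l : seq I) (k : I -> R) (v : I -> rough_section E) :
  (forall i, smooth_sec (v i)) -> smooth_sec (fun q => \sum_(i <- l) k i *: v i q).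
Proof.
move=> sv; apply: (smooth_sec_on_sum oT l) => i.
exact: (smooth_sec_onZ oT (smooth_on_cst oT (k i)) (sv i)).
Qed.

Lemma bracket_sum u I (l : seq I) (k : I -> R) (v : I -> rough_section E) p :
  smooth_sec u -> (forall i, smooth_sec (v i)) ->
  bracket u (fun q => \sum_(i <- l) k i *: v i q) p
    = \sum_(i <- l) k i *: bracket u (v i) p.
Proof.
move=> su sv; elim: l => [|i l ih].
  rewrite big_nil -(bracket0 p su); by apply: eq_sec_map => q; rewrite big_nil.
rewrite big_cons -ih -(bracket_linear (k i) su (sv i) (smooth_sec_lincomb _ _ sv)).
by apply: eq_sec_map => q; rewrite big_cons.
Qed.

(** In the Leibniz rule the derivative of [chi] vanishes at [p], since [chi] is constant near
    [p]. *)
Lemma bracket_cutoff u v chi p : smooth_sec u -> smooth_sec v ->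
  smooth_on setT chi -> (\forall q \near p, chi q = 1) ->
  bracket u (fun q => chi q *: v q) p = bracket u v p.
Proof.
move=> su sv schi chi1.
rewrite bracket_leibniz // (nbhs_singleton chi1) scale1r.
rewrite (@anchor_local _ (u p) chi (fun=> 1)) ?anchor_cst ?scale0r ?add0r //.
  exact: smooth_at_on schi.
exact: (smooth_at_on oT _ (smooth_on_cst oT 1)).
Qed.

(** If [chi] vanishes outside the set where [v] and [v'] agree, then [chi v] and [chi v'] are the
    same section, and [bracket_cutoff] removes [chi]. *)
Lemma bracket_local u v v' p : smooth_sec u -> smooth_sec v -> smooth_sec v' ->
  (\forall q \near p, v q = v' q) -> bracket u v p = bracket u v' p.
Proof.
move=> su sv sv'; rewrite /prop_near1 /= nbhsE /= => -[U [oU Up] vv'].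
have [chi [W [schi chi1 oW chi0 UW]]] := bump_function oU Up.
rewrite -(bracket_cutoff su sv schi chi1) -(bracket_cutoff su sv' schi chi1).
apply: eq_sec_map => q.
by have [/vv' /= ->//|/chi0 ->] := UW q; rewrite !scale0r.
Qed.

Lemma bracket_local2 u u' v v' p :
  smooth_sec u -> smooth_sec u' -> smooth_sec v -> smooth_sec v' ->
  (\forall q \near p, u q = u' q) -> (\forall q \near p, v q = v' q) ->
  bracket u v p = bracket u' v' p.
Proof.
move=> su su' sv sv' uu vv.
rewrite (bracket_local su sv sv' vv) (bracket_anti su sv').
by rewrite (bracket_local sv' su su' uu) -(bracket_anti su' sv').
Qed.

Lemma exists_anchor_components c U (s : 'I_r -> rough_section E) : atlas c ->
  exists QA, anchor_components c U s QA.
Proof.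
move=> ac.
have /choice[k kP] : forall ap : 'I_r * M, exists k : 'rV[R]_n, cdom c ap.2 ->
    forall f, smooth_at ap.2 f ->
    anchor (s ap.1 ap.2) f = \sum_A k 0 A * ddx c A f ap.2.
  move=> [a p] /=; have [cp|ncp] := pselect (cdom c p); last by exists 0.
  by have [k ke] := anchor_tangent (s a p) ac cp; exists k.
by exists (fun a A p => k (a, p) 0 A) => a p _ cp f sf; rewrite (kP (a, p)).
Qed.

(** The components are chosen point by point. If the two frame sections have global extensions near
    [p], one pair of them fixes the value and [bracket_local2] makes it independent of the pair; if
    not, the condition is empty and 0 serves. *)
Lemma exists_bracket_components U (s : 'I_r -> rough_section E) :
  local_frame U s -> exists Qb, bracket_components U s Qb.
Proof.
move=> [_ bs].
pose good (abp : 'I_r * 'I_r * M) (k : 'rV[R]_r) := U abp.2 ->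
  forall v w, smooth_sec v -> smooth_sec w ->
  (\forall q \near abp.2, v q = s abp.1.1 q) ->
  (\forall q \near abp.2, w q = s abp.1.2 q) ->
  bracket v w abp.2 = \sum_d k 0 d *: s d abp.2.
have /choice[k kP] : forall abp, exists k, good abp k.
  move=> [[a b] p]; rewrite /good /=.
  have [Up|nUp] := pselect (U p); last by exists 0.
  have [[v0 [w0 [sv0 sw0 va wb]]]|none] := pselect (exists v w : rough_section E,
      [/\ smooth_sec v, smooth_sec w, \forall q \near p, v q = s a q &
        \forall q \near p, w q = s b q]); last first.
    by exists 0 => _ v w sv sw va wb; case: none; exists v, w.
  have [inv _ invK] := bs p Up.
  exists (inv (bracket v0 w0 p)) => _ v w sv sw va' wb'.
  rewrite -[RHS]/(frame_comb s p _) invK; apply: bracket_local2 => //.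
    by near=> q; transitivity (s a q); [|symmetry]; near: q.
  by near=> q; transitivity (s b q); [|symmetry]; near: q.
exists (fun a b d p => k (a, b, p) 0 d) => a b p Up v w sv sw va wb.
exact: (kP (a, b, p)).
Unshelve. all: by end_near.
Qed.

(** * Metric, Levi-Civita connection and the central identity *)

Section Metric.
Variable g : riemannian_metric E.

Lemma inner_linearr p k (e e' e'' : E p) :
  g p e'' (k *: e + e') = k * g p e'' e + g p e'' e'.
Proof. by rewrite inner_sym inner_linear !(inner_sym g e''). Qed.

Lemma inner0 p (e : E p) : g p 0 e = 0.
Proof.
have := inner_linear g (-1) 0 0 e.
by rewrite scaler0 addr0 mulN1r addNr.
Qed.

Lemma innerD p (e e' e'' : E p) : g p (e + e') e'' = g p e e'' + g p e' e''.
Proof. by rewrite -[e]scale1r inner_linear mul1r scale1r. Qed.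

Lemma innerB p (e e' e'' : E p) : g p (e - e') e'' = g p e e'' - g p e' e''.
Proof. by rewrite addrC -scaleN1r inner_linear mulN1r addrC. Qed.

Lemma inner_sum p I (l : seq I) (k : I -> R) (e : I -> E p) e' :
  g p (\sum_(i <- l) k i *: e i) e' = \sum_(i <- l) k i * g p (e i) e'.
Proof.
elim: l => [|i l ih]; first by rewrite !big_nil inner0.
by rewrite !big_cons inner_linear ih.
Qed.

Lemma frame_combZD (s : 'I_r -> rough_section E) p h d y :
  frame_comb s p (h *: 'e_d + y) = h *: s d p + frame_comb s p y.
Proof.
rewrite /frame_comb.
under eq_bigr do rewrite !mxE scalerDl.
rewrite big_split /=; congr (_ + _).
rewrite (bigD1 d) //= !eqxx mulr1 big1 ?addr0 // => a ad.
by rewrite (negbTE ad) mulr0 scale0r.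
Qed.

(** The function is quadratic, so its difference quotient in the step [h] is exactly [B + h * C]. *)
Lemma derive_metric_fibre (s : 'I_r -> rough_section E) p d (y : 'rV[R]_r) :
  'D_'e_d (fun z : 'rV[R]_r => g p (frame_comb s p z) (frame_comb s p z)) y
  = 2 * g p (s d p) (frame_comb s p y).
Proof.
set B := 2 * _; pose C := g p (s d p) (s d p).
apply: cvg_lim => //.
apply: (@cvg_trans _ ((B + h * C) @[h --> (0 : R)^'])); last first.
  have -> : nbhs B = nbhs (B + 0 * C) by rewrite mul0r addr0.
  apply: cvg_within_filter; apply: cvgD; first exact: cvg_cst.
  by apply: cvgM; [exact: cvg_id|exact: cvg_cst].
apply: near_eq_cvg; near=> h.
have h0 : h != 0 by near: h; exact: nbhs_dnbhs_neq.
rewrite /= frame_combZD !inner_linear !inner_linearr (inner_sym g _ (s d p)).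
rewrite /GRing.scale /= /B -/C.
by field.
Unshelve. all: by end_near.
Qed.

Variable nabla : rough_section E -> rough_section E -> rough_section E.
Hypothesis hnabla : levi_civita g nabla.
Let hconn := lc_connection hnabla.

Lemma nabla_sum I (l : seq I) (k : I -> M -> R) (v : I -> rough_section E) u p :
  (forall i, smooth_on setT (k i)) -> (forall i, smooth_sec (v i)) -> smooth_sec u ->
  nabla (fun q => \sum_(i <- l) k i q *: v i q) u p
    = \sum_(i <- l) k i p *: nabla (v i) u p.
Proof.
move=> sk sv su.
have skv i : smooth_sec (fun q => k i q *: v i q).
  exact: (smooth_sec_onZ oT (sk i) (sv i)).
elim: l => [|i l ih].
  have := nabla_scale hconn (smooth_sec_on0 oT) su (smooth_on_cst oT 0) p.
  rewrite big_nil scale0r => <-.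
  by apply: (eq_sec_map (nabla^~ u)) => q; rewrite big_nil scaler0.
rewrite big_cons -ih -(nabla_scale hconn (sv i) su (sk i)).
rewrite -(nabla_addl hconn (skv i) (smooth_sec_on_sum oT l skv) su).
by apply: (eq_sec_map (nabla^~ u)) => q; rewrite big_cons.
Qed.

(** The cut-off enters twice, once to make the coefficients global and once to make the frame
    sections global. *)
Lemma cutoff_expansion U W (s : 'I_r -> rough_section E) v (vc : 'I_r -> M -> R) chi :
  (forall p, U p -> v p = \sum_a vc a p *: s a p) ->
  (forall q, W q -> chi q = 0) -> (forall q, U q \/ W q) ->
  (fun q => chi q *: (chi q *: v q))
    = (fun q => \sum_a (chi q * vc a q) *: (chi q *: s a q)).
Proof.
move=> ve chi0 UW; apply: sec_ext => q; have [Uq|Wq] := UW q.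
  rewrite ve // !scaler_sumr; apply: eq_bigr => a _.
  by rewrite !scalerA; congr (_ *: _); ring.
by rewrite (chi0 q Wq) scale0r big1 // => a _; rewrite scale0r scaler0.
Qed.

(** Linearity over functions, applied to the expansion in a cut-off frame, gives a formula in which
    the first argument enters only through its coordinates at [p]. *)
Lemma nabla_tensorial v v' u p : smooth_sec v -> smooth_sec v' -> smooth_sec u ->
  v p = v' p -> nabla v u p = nabla v' u p.
Proof.
move=> sv sv' su.
have [t tt tp] := trivs_cover E p.
have oU := tdom_open t.
have [chi [W [schi chi1 oW chi0 UW]]] := bump_function oU tp.
have chip := nbhs_singleton chi1.
have [ss bs] := triv_local_frame tt.
have expand w : smooth_sec w -> nabla w u p =
    \sum_a tcoord t (w p) 0 a *: nabla (fun q => chi q *: triv_frame t a q) u p.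
  move=> sw.
  pose wc a q := tcoord t (w q) 0 a.
  have we q : tdom t q -> w q = \sum_a wc a q *: triv_frame t a q.
    by move=> tq; rewrite -[RHS]/(frame_comb _ _ (tcoord t (w q))) triv_frame_comb // tcoordK.
  have swc a : smooth_on (tdom t) (wc a).
    exact: frame_coord_smooth oU (triv_local_frame tt) (smooth_secE sw) we a.
  have schiw : smooth_sec (fun q => chi q *: w q) := smooth_sec_onZ oT schi sw.
  transitivity (nabla (fun q => chi q *: (chi q *: w q)) u p).
    rewrite (nabla_scale hconn schiw su schi) (nabla_scale hconn sw su schi).
    by rewrite chip !scale1r.
  rewrite (cutoff_expansion we chi0 UW) (nabla_sum _ _ _ _ su).
  - by apply: eq_bigr => a _; rewrite chip mul1r.
  - by move=> a; exact: (cutoff_smooth oU schi oW chi0 UW (swc a)).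
  - by move=> a; exact: (cutoff_smooth_sec oU schi oW chi0 UW (ss a)).
by move=> vv'; rewrite !expand // vv'.
Qed.

Lemma tangent_lift_metric c U (s : 'I_r -> rough_section E) QA Qb uc u v p y :
  atlas c -> open U -> local_frame U s ->
  anchor_components c U s QA -> bracket_components U s Qb ->
  smooth_sec u -> (forall p, U p -> u p = \sum_a uc a p *: s a p) ->
  U p -> cdom c p -> smooth_sec v -> v p = frame_comb s p y ->
  tangent_lift_coord c s QA Qb uc (metric_function g) p y
    = 2 * g p (nabla v u p) (v p).
Proof.
move=> ac oU fr hA hb su ue Up cp sv vy.
have [ss bs] := fr.
have suc := frame_coord_smooth oU fr (smooth_secE su) ue.
have [chi [W [schi chi1 oW chi0 UW]]] := bump_function oU Up.
have chip := nbhs_singleton chi1.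
pose sg a q := chi q *: s a q : E q.
pose ug a q := chi q * uc a q.
have ssg a : smooth_sec (sg a) by exact: (cutoff_smooth_sec oU schi oW chi0 UW (ss a)).
have sug a : smooth_on setT (ug a) by exact: (cutoff_smooth oU schi oW chi0 UW (suc a)).
have sgn a : \forall q \near p, sg a q = s a q.
  by apply: filterS chi1 => q chiq; rewrite /sg chiq scale1r.
(* Near [p] this section has the constant components [y], so [G] below is the squared norm of [V]
   there. *)
pose V q := \sum_a y 0 a *: sg a q : E q.
have VE q : V q = chi q *: frame_comb s q y.
  rewrite scaler_sumr; apply: eq_bigr => a _.
  by rewrite /sg !scalerA mulrC.
have sV : smooth_sec V.
  exact: smooth_sec_lincomb.
have Vp : V p = frame_comb s p y by rewrite VE chip scale1r.
rewrite (nabla_tensorial sv sV su) ?vy ?Vp // -Vp.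
pose G q := g q (frame_comb s q y) (frame_comb s q y).
have sGU : smooth_on U G.
  by apply: inner_smooth => //; exact: smooth_sec_on_frame_comb.
have sG : smooth_at p G by exact: (smooth_at_on oU Up sGU).
have anchor_u : \sum_A (\sum_a uc a p * QA a A p) * ddx c A G p
    = 2 * g p (nabla u V p) (V p).
  transitivity (anchor (u p) G).
    rewrite (ue p Up) (anchor_sum _ _ _ sG).
    under eq_bigr do rewrite mulr_suml.
    rewrite exchange_big; apply: eq_bigr => a _.
    rewrite (hA a p Up cp _ sG) mulr_sumr; apply: eq_bigr => A _; ring.
  have sGV := smooth_at_on (p := p) oT I (inner_smooth g oT sV sV).
  rewrite (anchor_local (u p) sG sGV).
    by rewrite (lc_metric hnabla su sV sV) (inner_sym g (V p)); ring.
  by apply: filterS chi1 => q chiq; rewrite /= VE chiq scale1r.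
(* The fibre components of the tangent lift; [buV] shows that they are the components of [[V, u]] at
   [p]. *)
pose X d := \sum_a \sum_A y 0 a * QA a A p * ddx c A (uc d) p
            - \sum_a \sum_b y 0 a * uc b p * Qb b a d p.
have X1 d : \sum_a \sum_A y 0 a * QA a A p * ddx c A (uc d) p
    = anchor (V p) (ug d).
  have sud : smooth_at p (uc d) by exact: (smooth_at_on oU Up (suc d)).
  have sugd : smooth_at p (ug d) by exact: (smooth_at_on oT I (sug d)).
  rewrite (anchor_local (V p) sugd sud); last first.
    by apply: filterS chi1 => q chiq; rewrite /ug chiq mul1r.
  rewrite Vp (anchor_sum _ _ _ sud); apply: eq_bigr => a _.
  rewrite (hA a p Up cp _ sud) mulr_sumr; apply: eq_bigr => A _; ring.
have bV b : bracket V (sg b) p = - \sum_a \sum_d (y 0 a * Qb b a d p) *: s d p.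
  rewrite (bracket_anti sV (ssg b)) (bracket_sum _ _ _ (ssg b) ssg).
  congr (- _); apply: eq_bigr => a _.
  rewrite (hb b a p Up _ _ (ssg b) (ssg a) (sgn b) (sgn a)) scaler_sumr; apply: eq_bigr => d _.
  by rewrite scalerA.
have buV : \sum_d X d *: s d p = bracket V u p.
  have schiu : smooth_sec (fun q => chi q *: u q) := smooth_sec_onZ oT schi su.
  rewrite -(bracket_cutoff sV su schi chi1) -(bracket_cutoff sV schiu schi chi1).
  rewrite (cutoff_expansion ue chi0 UW).
  have -> : bracket V (fun q => \sum_a (chi q * uc a q) *: (chi q *: s a q)) p
      = \sum_a bracket V (fun q => ug a q *: sg a q) p.
    (* [bracket_sum] takes constant coefficients, so the functions [ug a] are kept inside the
       sections and released afterwards by the Leibniz rule. *)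
    transitivity (bracket V (fun q => \sum_a 1 *: (ug a q *: sg a q)) p).
      by apply: eq_sec_map => q; apply: eq_bigr => a _; rewrite scale1r.
    rewrite (bracket_sum _ _ _ sV); last first.
      by move=> a; exact: (smooth_sec_onZ oT (sug a) (ssg a)).
    by apply: eq_bigr => a _; rewrite scale1r.
  under [RHS]eq_bigr do
    rewrite (bracket_leibniz sV (ssg _) (sug _)) -X1 /ug chip mul1r bV scalerN /sg
      chip scale1r.
  rewrite big_split /= sumrN.
  under eq_bigr do rewrite /X scalerBl.
  rewrite sumrB; congr (_ - _).
  transitivity (\sum_d \sum_b \sum_a (y 0 a * uc b p * Qb b a d p) *: s d p).
    apply: eq_bigr => d _; rewrite scaler_suml exchange_big /=.
    by under eq_bigr do rewrite scaler_suml; rewrite exchange_big.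
  rewrite exchange_big; apply: eq_bigr => b _.
  rewrite exchange_big scaler_sumr; apply: eq_bigr => a _.
  rewrite scaler_sumr; apply: eq_bigr => d _.
  by rewrite scalerA; congr (_ *: _); ring.
rewrite /tangent_lift_coord /metric_function anchor_u.
(* The fibre part sums to 2 <[V, u] | V>; absence of torsion splits it into 2 <nabla_V u | V> - 2
   <nabla_u V | V>, whose second term cancels [anchor_u]. *)
under [X in _ + X]eq_bigr do rewrite derive_metric_fibre -Vp -/(X _) mulrCA.
rewrite -mulr_sumr -inner_sum buV -(lc_torsionless hnabla sV su) innerB.
ring.
Qed.

End Metric.
End Algebroid.

Theorem theorem3p4 (R : realType) (n r : nat) (M : manifold R n)
    (E : lie_algebroid M r) (g : riemannian_metric E)
    (nabla : rough_section E -> rough_section E -> rough_section E)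
    (hnabla : levi_civita g nabla)
    (u : rough_section E) (hu : smooth_sec u) :
  killing g u <->
  (forall v w : rough_section E, smooth_sec v -> smooth_sec w ->
     forall p : M, g p (nabla v u p) (w p) + g p (nabla w u p) (v p) = 0).
Proof.
split=> [kill|skew].
- have diag v p : smooth_sec v -> g p (nabla v u p) (v p) = 0.
    move=> sv; have [c ac cp] := atlas_cover p.
    have [t tt tp] := trivs_cover E p.
    have fr := triv_local_frame tt.
    have [QA hA] := exists_anchor_components (tdom t) (triv_frame t) ac.
    have [Qb hb] := exists_bracket_components fr.
    have coordE w q : tdom t q -> w q = frame_comb (triv_frame t) q (tcoord t (w q)).
      by move=> tq; rewrite triv_frame_comb // tcoordK.
    have := kill c (tdom t) (triv_frame t) QA Qb (fun a q => tcoord t (u q) 0 a)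
      ac (tdom_open t) fr hA hb (coordE u) p (tcoord t (v p)) tp cp.
    rewrite (tangent_lift_metric hnabla ac (tdom_open t) fr hA hb hu (coordE u) tp cp sv
      (coordE v p tp)).
    by move/eqP; rewrite mulf_eq0 pnatr_eq0 => /eqP.
  move=> v w sv sw p.
  have := diag _ p (smooth_sec_onD openT sv sw).
  rewrite (nabla_addl (lc_connection hnabla) sv sw hu) innerD.
  rewrite !(inner_sym g _ (v p + w p)) !innerD.
  rewrite -!(inner_sym g (nabla _ _ p)) !diag //.
  by rewrite add0r addr0.
- move=> c U s QA Qb uc ac oU fr hA hb ue p y Up cp.
  have [ss _] := fr.
  have [chi [W [schi chi1 oW chi0 UW]]] := bump_function oU Up.
  (* A global smooth section through the point of the fibre with coordinates [y]; the hypothesis is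
     then used with both sections equal to it. *)
  pose v q := chi q *: frame_comb s q y : E q.
  have sv : smooth_sec v.
    exact: (cutoff_smooth_sec oU schi oW chi0 UW (smooth_sec_on_frame_comb oU y ss)).
  rewrite (tangent_lift_metric hnabla ac oU fr hA hb hu ue Up cp sv).
    by rewrite mulrDl mul1r skew.
  by rewrite /v (nbhs_singleton chi1) scale1r.
Qed.
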